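(* For each integer $b\ge1$, let $L_b^{\mathrm{box}}=\{w\in\{0,1\}^*\mid |w|_0=|w|_1=2b,\ \forall k\in\{1,\dots,b\}:\ \delta_{k,k}^{2b}(w)\in\{0101,1010,0110,1001\}\}$. Then $L_b^{\mathrm{box}}$ is $2b$-uniform and $\mathcal{G}_{L_b^{\mathrm{box}}}$ is exactly the class of graphs of boxicity at most $b$.
   Context: $|w|_a$ is the number of occurrences of letter $a$ in $w$; a binary word is $k$-uniform if it has exactly $k$ occurrences of $0$ and of $1$. For a $2b$-uniform binary word $w$ and $k\in\{1,\dots,b\}$, $\delta_{k,k}^{2b}(w)$ is obtained from $w$ by deleting all occurrences of $0$ except the $(2k-1)$-st and $2k$-th, and all occurrences of $1$ except the $(2k-1)$-st and $2k$-th. For a word $w$ and distinct letters $a,b$, $h_{a,b}(w)$ replaces $a$ by $0$, $b$ by $1$ and deletes other letters. For $L\subseteq\{0,1\}^*$ closed under exchanging $0$ and $1$ and a word $w$ with letter set $V$, $G(L,w)$ is the graph on $V$ where distinct $u,v$ are adjacent iff $h_{u,v}(w)\in L$; $\mathcal{G}_L$ is the class of graphs isomorphic to some $G(L,w)$. A graph has boxicity at most $b$ if it is the intersection graph of a family of axis-parallel boxes $[\ell_1,r_1]\times\dots\times[\ell_b,r_b]$ in $\mathbb{R}^b$ (one per vertex, adjacency iff the boxes intersect). *)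

(* Defs.v *)
From HB Require Import structures.
From mathcomp Require Import all_boot all_order all_algebra.
From mathcomp Require Import boolp classical_sets reals.

Set Implicit Arguments.
Unset Strict Implicit.
Unset Printing Implicit Defensive.

Import Order.TTheory GRing.Theory Num.Theory.

(* A binary word is a [seq bool]; [false] is the letter 0, [true] the letter 1. *)
Definition uniform_word (k : nat) (w : seq bool) : bool :=
  (count_mem false w == k) && (count_mem true w == k).

Definition uniform_language (k : nat) (L : pred (seq bool)) : Prop :=
  forall w, L w -> uniform_word k w.

Record sym_language := SymLanguage {
  language :> pred (seq bool);
  language_swap : forall w, language (map negb w) = language w }.

(* The letter at position [i] of [w] is its [occurrence w i]-th occurrence,
   counted from 1; the default of [nth] is irrelevant when [i < size w]. *)
Definition occurrence (w : seq bool) (i : nat) : nat :=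
  count_mem (nth false w i) (take i.+1 w).

(* [delta k w] is $\delta_{k,k}^{2b}(w)$; the value does not depend on b.
   Only k >= 1 is meaningful. *)
Definition delta (k : nat) (w : seq bool) : seq bool :=
  mask [seq occurrence w i \in [:: 2 * k - 1; 2 * k] | i <- iota 0 (size w)] w.

Definition overlap_words : seq (seq bool) :=
  [:: [:: false; true; false; true]; [:: true; false; true; false];
      [:: false; true; true; false]; [:: true; false; false; true] ].

Definition box_pred (b : nat) : pred (seq bool) := fun w =>
  [&& count_mem false w == 2 * b, count_mem true w == 2 * b
    & all (fun k => delta k w \in overlap_words) (iota 1 b)].

Lemma delta_swap k w : delta k (map negb w) = map negb (delta k w).
Proof.
rewrite /delta size_map map_mask; congr mask.
apply/eq_in_map => i; rewrite mem_iota add0n => /= ltiw.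
rewrite /occurrence (nth_map false) // -map_take count_map.
by rewrite (@eq_count _ _ (pred1 (nth false w i))) // => x /=; rewrite (inj_eq negb_inj).
Qed.

Lemma box_pred_swap b w : box_pred b (map negb w) = box_pred b w.
Proof.
rewrite /box_pred !count_map.
rewrite (@eq_count _ (preim negb (pred1 false)) (pred1 true)); last by move=> [].
rewrite (@eq_count _ (preim negb (pred1 true)) (pred1 false)); last by move=> [].
rewrite andbCA; congr [&& _, _ & _]; apply: eq_all => k.
rewrite delta_swap -[RHS](mem_map (inj_map negb_inj)) !inE.
by rewrite [LHS]orbCA [in LHS](orbC (_ == [:: false; true; true; false])).
Qed.

Definition box_language (b : nat) : sym_language :=
  SymLanguage (box_pred_swap b).

Record sgraph := SGraph {
  vertex :> finType;
  edge : rel vertex;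
  edge_sym : symmetric edge;
  edge_irr : irreflexive edge }.

Definition isomorphic (G H : sgraph) : Prop :=
  exists2 f : G -> H, bijective f & forall u v, edge (f u) (f v) = edge u v.

Section WordGraph.
Variables (L : sym_language) (A : choiceType) (w : seq A).

Definition proj (a b : A) (s : seq A) : seq bool :=
  pmap (fun x => if x == a then Some false
                 else if x == b then Some true else None) s.

Lemma proj_swap a b s : a != b -> proj b a s = map negb (proj a b s).
Proof.
move=> neab; elim: s => //= x s ->.
case: (eqVneq x a) => [->|_]; first by rewrite (negbTE neab).
by case: eqP.
Qed.

(* The vertices are the letters that occur in [w]. *)
Definition word_edge : rel (seq_sub w) :=
  fun u v => (u != v) && L (proj (val u) (val v) w).

Lemma word_edge_sym : symmetric word_edge.
Proof.
move=> u v; rewrite /word_edge eq_sym; case: eqVneq => //= nevu.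
by rewrite (@proj_swap (val v) (val u)) ?(inj_eq val_inj) // language_swap.
Qed.

Lemma word_edge_irr : irreflexive word_edge.
Proof. by move=> u; rewrite /word_edge eqxx. Qed.

Definition word_graph : sgraph := SGraph word_edge_sym word_edge_irr.

End WordGraph.

Definition word_graph_class (L : sym_language) (G : sgraph) : Prop :=
  exists (A : choiceType) (w : seq A), isomorphic G (word_graph L w).

Section Boxicity.
Variable R : realType.
Local Open Scope ring_scope.
Local Open Scope classical_set_scope.

Definition box (b : nat) (l r : 'rV[R]_b) : set 'rV[R]_b :=
  [set x | forall i, l ord0 i <= x ord0 i <= r ord0 i].

Definition boxicity_le (b : nat) (G : sgraph) : Prop :=
  exists l r : G -> 'rV[R]_b,
    (forall v i, l v ord0 i <= r v ord0 i) /\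
    (forall u v, u != v ->
       (edge u v <-> box (l u) (r u) `&` box (l v) (r v) !=set0)).

End Boxicity.

(* Main.v *)
(* The k-th pair of occurrences of a letter is read as an interval of positions,
   the k-th side of a box. Among the words with two 0s and two 1s, the overlap
   words are exactly those in which the two intervals meet, and deleting other
   letters does not change the relative order of the remaining occurrences. This
   turns a word into boxes whose coordinates are positions. Conversely, sorting
   the endpoints of the sides along each axis, left ends first among equal
   values, and concatenating these words over the axes represents the
   intersection graph of given boxes. *)

Require Import Defs.
From mathcomp Require Import all_boot all_order all_algebra.
From mathcomp Require Import classical_sets reals.
From mathcomp Require Import zify.

Set Implicit Arguments.
Unset Strict Implicit.
Unset Printing Implicit Defensive.

Import Order.TTheory GRing.Theory Num.Theory.

Lemma prefix_of_rcons (T : eqType) (p s : seq T) x :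
  prefix p (rcons s x) = prefix p s || (p == rcons s x).
Proof.
by elim: s p => [|y s IHs] [|z p] //=; rewrite IHs eqseq_cons andb_orr.
Qed.

Lemma count_flatten_const (T : Type) (a : pred T) d (ss : seq (seq T)) :
  all (fun s => count a s == d) ss -> count a (flatten ss) = d * size ss.
Proof.
rewrite count_flatten; elim: ss => [|s ss IHs] /=; first by rewrite muln0.
by case/andP=> /eqP-> /IHs->; rewrite mulnS.
Qed.

Lemma count_map_snd (T : eqType) (t : seq (bool * T)) v : uniq t ->
  count_mem v [seq e.2 | e <- t] = ((false, v) \in t) + ((true, v) \in t).
Proof.
elim: t => //= -[s x] t IHt /andP[xt uniq_t]; rewrite IHt // !inE.
have [<-|nexv] := eqVneq x v.
  by case: s xt => /negbTE xt; rewrite xt !xpair_eqE !eqxx /=; lia.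
by rewrite !xpair_eqE ![v == x]eq_sym (negbTE nexv) !andbF.
Qed.

Section Position.
Variable T : eqType.
Implicit Types (w s : seq T) (ss : seq (seq T)) (a c : T).

(* The [n]-th occurrence of [a] in [w], both it and its position being counted
   from 1; the value is [(size w).+1] if [a] occurs less than [n] times. *)
Definition position w a n : nat :=
  find (fun i => n <= count_mem a (take i w)) (iota 0 (size w).+1).

Lemma position_leq w a n i : i <= size w ->
  (position w a n <= i) = (n <= count_mem a (take i w)).
Proof.
move=> lei; rewrite -ltnS -has_take_leq ?size_iota // take_iota (minn_idPl _) //.
apply/hasP/idP => [[j]|len]; last by exists i; rewrite ?mem_iota /=.
rewrite mem_iota ltnS => leji /leq_trans; apply.
by rewrite -(take_takel w leji); apply/leq_count_subseq/take_subseq.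
Qed.

Lemma position_leq_size w a n :
  (position w a n <= size w) = (n <= count_mem a w).
Proof. by rewrite position_leq // take_size. Qed.

Lemma position_leq_sizeS w a n : position w a n <= (size w).+1.
Proof. by rewrite -[leqRHS](size_iota 0) find_size. Qed.

Lemma position_mono w a m n : m <= n -> position w a m <= position w a n.
Proof. by move=> lemn; apply: sub_find => i; apply: leq_trans. Qed.

Lemma ltn_positionP w a c m n :
  reflect (exists p, [/\ prefix p w, m <= count_mem a p & count_mem c p < n])
          (position w a m < position w c n).
Proof.
apply: (iffP idP) => [lt_pos|[p [pre_p lea ltc]]].
  have le_size : position w a m <= size w.
    by rewrite -ltnS (leq_trans lt_pos) ?position_leq_sizeS.
  exists (take (position w a m) w).
  by rewrite prefix_take ltnNge -!position_leq // leqnn -ltnNge.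
have le_size := size_prefix pre_p; move: pre_p; rewrite prefixE => /eqP dp.
apply: (@leq_ltn_trans (size p)); first by rewrite position_leq ?dp.
by rewrite ltnNge position_leq ?dp // -ltnNge.
Qed.

Lemma position_nth x0 w i : i < size w ->
  position w (nth x0 w i) (count_mem (nth x0 w i) (take i w)).+1 = i.+1.
Proof.
move=> ltiw; apply/eqP; rewrite eqn_leq position_leq // [i < _]ltnNge.
rewrite position_leq ?(ltnW ltiw) // ltnn (take_nth x0) //.
by rewrite -cats1 count_cat /= eqxx addn1 andbT.
Qed.

Lemma position_catl s t a n :
  n <= count_mem a s -> position (s ++ t) a n = position s a n.
Proof.
move=> len; rewrite /position size_cat -addSn iotaD find_cat.
have eq_s : {in iota 0 (size s).+1,
    (fun i => n <= count_mem a (take i (s ++ t)))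
      =1 (fun i => n <= count_mem a (take i s))}.
  by move=> i; rewrite mem_iota => /= lei; rewrite takel_cat.
rewrite (eq_in_has eq_s) (eq_in_find eq_s) ifT //.
by apply/hasP; exists (size s); rewrite ?take_size // mem_iota /=.
Qed.

Lemma position_catr s t a n :
  0 < n -> position (s ++ t) a (count_mem a s + n) = size s + position t a n.
Proof.
move=> n_gt0; rewrite /position size_cat -addnS iotaD find_cat ifF; last first.
  apply/negbTE/hasP => -[i]; rewrite mem_iota => /= lti.
  rewrite takel_cat ?(ltnW lti) // leqNgt; case/negP.
  have := leq_count_subseq (pred1 a) (take_subseq s i); lia.
rewrite size_iota add0n -[X in iota X]addn0 iotaDl find_map.
congr addn; apply: eq_find => i /=.
by rewrite take_cat ltnNge leq_addr /= addKn count_cat leq_add2l.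
Qed.

Lemma position_flatten d ss a k n :
    all (fun s => count_mem a s == d) ss -> k < size ss -> 0 < n <= d ->
  position (flatten ss) a (d * k + n) =
  size (flatten (take k ss)) + position (nth [::] ss k) a n.
Proof.
move=> count_ss ltk /andP[n_gt0 len].
have /eqP count_k := all_nthP [::] count_ss k ltk.
rewrite -{1}(cat_take_drop k ss) (drop_nth [::] ltk) flatten_cat /=.
rewrite -[d * k](_ : count_mem a (flatten (take k ss)) = _).
  by rewrite position_catr ?position_catl ?count_k.
rewrite (count_flatten_const (d := d)) ?size_takel ?(ltnW ltk) //.
by move: count_ss; rewrite -{1}(cat_take_drop k ss) all_cat => /andP[].
Qed.

End Position.

Definition incremental (T U : Type) (f : seq T -> seq U) : Prop :=
  f [::] = [::] /\
  forall s x, exists2 t, size t <= 1 & f (rcons s x) = f s ++ t.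

Lemma prefix_incremental (T U : eqType) (f : seq T -> seq U) s q :
  incremental f -> prefix q (f s) <-> exists2 p, prefix p s & q = f p.
Proof.
case=> f_nil f_rcons; elim/last_ind: s q => [|s x IHs] q.
  rewrite f_nil prefixs0; split=> [/eqP->|[p]]; first by exists [::].
  by rewrite prefixs0 => /eqP-> ->; rewrite f_nil.
have prefix_s : prefix q (f s) -> exists2 p, prefix p (rcons s x) & q = f p.
  by case/IHs=> p pre_p ->; exists p; rewrite ?prefix_of_rcons ?pre_p.
split=> [|[p]]; last first.
  rewrite prefix_of_rcons => /orP[pre_p|/eqP->] ->; last exact: prefix_refl.
  have [t _ ->] := f_rcons s x.
  by apply: prefix_catl; apply/IHs; exists p.
have [t] := f_rcons s x; case: t => [|y [|//]] _ f_sx.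
  by rewrite f_sx cats0.
rewrite f_sx cats1 prefix_of_rcons => /orP[//|/eqP->].
by exists (rcons s x); rewrite ?prefix_refl // f_sx cats1.
Qed.

Lemma leq_position_incremental (T U : eqType) (f : seq T -> seq U)
    w a c m n a' c' m' n' :
    incremental f ->
    (forall s, (m' <= count_mem a' (f s)) = (m <= count_mem a s)) ->
    (forall s, (n' <= count_mem c' (f s)) = (n <= count_mem c s)) ->
  (position (f w) a' m' <= position (f w) c' n') =
  (position w a m <= position w c n).
Proof.
move=> f_incr eq_a eq_c; rewrite leqNgt [RHS]leqNgt; congr negb.
apply/ltn_positionP/ltn_positionP => -[p [pre_p]].
  have [q pre_q ->] := (prefix_incremental w p f_incr).1 pre_p.
  by rewrite eq_c ltnNge eq_a -ltnNge; exists q.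
move=> lec lta; exists (f p); rewrite eq_c ltnNge eq_a -ltnNge.
by split=> //; apply/(prefix_incremental _ _ f_incr); exists p.
Qed.

Lemma incremental_pmap (T U : Type) (f : T -> option U) : incremental (pmap f).
Proof.
split=> // s x; exists (pmap f [:: x]); last by rewrite -cats1 pmap_cat.
by rewrite size_pmap /=; case: (f x).
Qed.

Lemma delta_rcons k s x :
  delta k (rcons s x) =
  delta k s ++ nseq (count_mem x (rcons s x) \in [:: 2 * k - 1; 2 * k]) x.
Proof.
rewrite -cats1 /delta size_cat iotaD map_cat.
rewrite mask_cat ?size_map ?size_iota //; congr (mask _ _ ++ _).
  apply/eq_in_map => i; rewrite mem_iota add0n => /= ltis.
  by rewrite /occurrence nth_cat ltis takel_cat.
rewrite /= /occurrence nth_cat ltnn subnn take_oversize ?size_cat ?addn1 //=.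
by case: (_ \in _).
Qed.

Lemma incremental_delta k : incremental (delta k).
Proof.
split=> // s x; rewrite delta_rcons.
by eexists; last reflexivity; rewrite size_nseq leq_b1.
Qed.

Lemma count_delta k s x :
  count_mem x (delta k.+1 s) = minn (count_mem x s) (2 * k + 2) - 2 * k.
Proof.
elim/last_ind: s => [|s y IHs] //; first by rewrite min0n.
rewrite delta_rcons count_cat IHs -!cats1 !count_cat /= !inE eqxx.
by have [->|neyx] := eqVneq y x; rewrite count_nseq /= ?eqxx ?(negbTE neyx); lia.
Qed.

Lemma count_proj (A : choiceType) (a c : A) (w : seq A) x : a != c ->
  count_mem x (proj a c w) = count_mem (if x then c else a) w.
Proof.
move=> neac; elim: w => //= y w <-.
have [->|neya] := eqVneq y a; first by case: x; rewrite ?eqxx ?(negbTE neac).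
by case: x; rewrite ?(negbTE neya); case: (y == c).
Qed.

(* The [n]-th occurrence of [a] has coordinate [x a n], and the [k]-th side of
   [a] runs from its (2k+1)-st to its (2k+2)-nd occurrence. The axis index [k]
   starts from 0, whereas that of [delta] starts from 1. *)
Definition sides_meet (T : Type) (x : T -> nat -> nat) (k : nat) (a c : T) :
  bool :=
  (x a (2 * k + 1) <= x c (2 * k + 2)) && (x c (2 * k + 1) <= x a (2 * k + 2)).

Lemma sides_meet_delta k s x y :
  sides_meet (position (delta k.+1 s)) 0 x y = sides_meet (position s) k x y.
Proof.
have incr := incremental_delta k.+1.
by rewrite /sides_meet; congr (_ && _);
   apply: (leq_position_incremental _ incr) => p; rewrite count_delta; lia.
Qed.

Lemma sides_meet_proj (A : choiceType) (a c : A) w k : a != c ->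
  sides_meet (position (proj a c w)) k false true =
  sides_meet (position w) k a c.
Proof.
move=> neac; rewrite /sides_meet; congr (_ && _);
  apply: leq_position_incremental => [|p|p]; rewrite ?count_proj //;
  exact: incremental_pmap.
Qed.

Lemma overlap_words_sides_meet s : uniform_word 2 s ->
  (s \in overlap_words) = sides_meet (position s) 0 false true.
Proof.
move=> uniform_s.
have : size s = 4.
  case/andP: uniform_s => /eqP c0 /eqP c1.
  by rewrite -(count_predC (pred1 false)) c0 -[4]/(2 + 2) -c1; congr addn;
     apply: eq_count => -[].
case: s uniform_s => [|x [|y [|z [|t [|? ?]]]]] //.
by case: x; case: y; case: z; case: t.
Qed.

Lemma delta_overlap_words k s :
    2 * k + 2 <= count_mem false s -> 2 * k + 2 <= count_mem true s ->
  (delta k.+1 s \in overlap_words) = sides_meet (position s) k false true.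
Proof.
move=> le0 le1; rewrite overlap_words_sides_meet ?sides_meet_delta //.
by rewrite /uniform_word !count_delta; lia.
Qed.

Lemma box_pred_proj (A : choiceType) b (a c : A) (w : seq A) : a != c ->
  box_pred b (proj a c w) =
  [&& count_mem a w == 2 * b, count_mem c w == 2 * b
    & [forall k : 'I_b, sides_meet (position w) k a c]].
Proof.
move=> neac; rewrite /box_pred !count_proj //.
case: eqP => //= ca; case: eqP => //= cc.
have overlap (k : 'I_b) : (delta k.+1 (proj a c w) \in overlap_words) =
    sides_meet (position w) k a c.
  have ltk := ltn_ord k.
  by rewrite delta_overlap_words ?count_proj ?sides_meet_proj // ?ca ?cc; lia.
apply/allP/forallP => [all_b k|meet [|k]]; last 2 first.
- by rewrite mem_iota.
- by rewrite mem_iota => ltkb; rewrite (overlap (Ordinal (ltkb : k < b))).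
by rewrite -overlap; apply: all_b; rewrite mem_iota add1n !ltnS ltn_ord.
Qed.

Section LetterCoordinates.
Variables (A : choiceType) (w : seq A) (b : nat).

(* A letter that does not occur exactly [2 * b] times is an isolated vertex:
   it gets a point of its own beyond all positions of [w]. *)
Definition letter_coord (a : A) (n : nat) : nat :=
  if count_mem a w == 2 * b then position w a n else size w + 1 + index a w.

Lemma letter_coord_mono a m n : m <= n -> letter_coord a m <= letter_coord a n.
Proof. by rewrite /letter_coord; case: eqP => // _; apply: position_mono. Qed.

Lemma box_pred_letter_coord a c :
    0 < b -> a \in w -> c \in w -> a != c ->
  box_pred b (proj a c w) = [forall k : 'I_b, sides_meet letter_coord k a c].
Proof.
move=> b_gt0 aw cw neac; rewrite box_pred_proj //.
have [/andP[/eqP ca /eqP cc]|not_uniform] :=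
    boolP ((count_mem a w == 2 * b) && (count_mem c w == 2 * b)).
  rewrite ca cc eqxx; apply: eq_forallb => k.
  by rewrite /sides_meet /letter_coord ca cc eqxx.
rewrite andbA (negbTE not_uniform); apply/esym/forallP => /(_ (Ordinal b_gt0)).
move: not_uniform; rewrite /sides_meet /letter_coord muln0 !add0n.
have neq_index : index a w <> index c w by move/(index_inj a aw cw); apply/eqP.
have position_le_size x : count_mem x w = 2 * b -> position w x 2 <= size w.
  by move=> cx; rewrite position_leq_size cx; lia.
case: eqP => [/position_le_size|] ?;
  by case: eqP => [/position_le_size|] ? //= _; lia.
Qed.

End LetterCoordinates.

Section EndpointWord.
Variables (d : Order.disp_t) (T : orderType d) (V : finType) (lo hi : V -> T).

(* The endpoint [(false, v)] is [lo v] and [(true, v)] is [hi v]; at equal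
   values left endpoints come first, so that touching closed intervals meet. *)
Definition endpoint_key (e : bool * V) : T *l bool :=
  ((if e.1 then hi e.2 else lo e.2), e.1).

Definition endpoint_le (e f : bool * V) : bool :=
  (endpoint_key e <= endpoint_key f)%O.

Definition endpoints : seq (bool * V) := sort endpoint_le (enum {: bool * V}).

Definition endpoint_word : seq V := [seq e.2 | e <- endpoints].

Lemma mem_endpoints e : e \in endpoints.
Proof. by rewrite mem_sort mem_enum. Qed.

Lemma endpoints_uniq : uniq endpoints.
Proof. by rewrite sort_uniq enum_uniq. Qed.

Lemma count_endpoint_word v : count_mem v endpoint_word = 2.
Proof. by rewrite count_map_snd ?endpoints_uniq // !mem_endpoints. Qed.

Lemma index_endpoints_leq e f : e.1 != f.1 ->
  (index e endpoints <= index f endpoints) = endpoint_le e f.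
Proof.
have le_of_index e' f' :
    index e' endpoints <= index f' endpoints -> endpoint_le e' f'.
  apply: sorted_leq_index; rewrite ?mem_endpoints //.
  - by move=> x y z; apply: le_trans.
  - by move=> x; apply: lexx.
  - by apply: sort_sorted => x y; apply: le_total.
move=> neq_side; apply/idP/idP => [/le_of_index//|le_ef].
rewrite leqNgt; apply/negP => /ltnW/le_of_index le_fe.
have [_ eq_side] : endpoint_key e = endpoint_key f.
  by apply/le_anti/andP.
by rewrite eq_side eqxx in neq_side.
Qed.

Hypothesis lo_le_hi : forall v, (lo v <= hi v)%O.

Lemma position_endpoint_word v (s : bool) :
  position endpoint_word v s.+1 = (index (s, v) endpoints).+1.
Proof.
set i := index _ _.
have lti : i < size endpoints by rewrite index_mem mem_endpoints.
have nth_i : nth v endpoint_word i = v.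
  by rewrite (nth_map (s, v)) // nth_index ?mem_endpoints.
have le_index : index (false, v) endpoints <= index (true, v) endpoints.
  by rewrite index_endpoints_leq // /endpoint_le lexi_pair lo_le_hi implybT.
have count_i : count_mem v (take i endpoint_word) = s.
  rewrite -map_take count_map_snd ?take_uniq ?endpoints_uniq //.
  rewrite !in_take ?mem_endpoints // /i.
  have : index (false, v) endpoints != index (true, v) endpoints.
    by apply/eqP => /(index_inj (s, v)); rewrite !mem_endpoints => /(_ isT isT).
  by case: s {i lti nth_i}; lia.
have := @position_nth _ v endpoint_word i.
by rewrite size_map nth_i count_i; apply.
Qed.

Lemma sides_meet_endpoint_word u v :
  sides_meet (position endpoint_word) 0 u v =
  (lo u <= hi v)%O && (lo v <= hi u)%O.
Proof.
rewrite /sides_meet -[2 * 0 + 1]/(false.+1) -[2 * 0 + 2]/(true.+1).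
rewrite !position_endpoint_word !ltnS !index_endpoints_leq //.
by rewrite /endpoint_le !lexi_pair !implybT !andbT.
Qed.

End EndpointWord.

Section BoxWord.
Variables (d : Order.disp_t) (T : orderType d) (V : finType) (b : nat).
Variables lo hi : 'I_b -> V -> T.

Definition axis_words : seq (seq V) :=
  [seq endpoint_word (lo i) (hi i) | i <- enum 'I_b].

Definition box_word : seq V := flatten axis_words.

Lemma count_axis_words v : all (fun s => count_mem v s == 2) axis_words.
Proof. by rewrite all_map; apply/allP => i _; rewrite /= count_endpoint_word. Qed.

Lemma size_axis_words : size axis_words = b.
Proof. by rewrite size_map size_enum_ord. Qed.

Lemma count_box_word v : count_mem v box_word = 2 * b.
Proof. by rewrite (count_flatten_const (count_axis_words v)) size_axis_words. Qed.

Hypothesis lo_le_hi : forall i v, (lo i v <= hi i v)%O.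

Lemma sides_meet_box_word (i : 'I_b) u v :
  sides_meet (position box_word) i u v =
  (lo i u <= hi i v)%O && (lo i v <= hi i u)%O.
Proof.
rewrite -sides_meet_endpoint_word // /sides_meet.
rewrite !(position_flatten (d := 2)) ?count_axis_words ?size_axis_words //.
rewrite !leq_add2l (nth_map i) ?size_enum_ord //.
by rewrite nth_ord_enum.
Qed.

End BoxWord.

Section Boxes.
Local Open Scope ring_scope.
Local Open Scope classical_set_scope.
Variables (R : realType) (b : nat).

Lemma box_meet (l r l' r' : 'rV[R]_b) :
    (forall i, l ord0 i <= r ord0 i) -> (forall i, l' ord0 i <= r' ord0 i) ->
  box l r `&` box l' r' !=set0 <->
  forall i, (l ord0 i <= r' ord0 i) && (l' ord0 i <= r ord0 i).
Proof.
move=> lr lr'; split=> [[x [bx bx']] i|meet].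
  have /andP[? ?] := bx i; have /andP[? ?] := bx' i.
  by apply/andP; split; apply: (@le_trans _ _ (x ord0 i)).
exists (\row_i Num.max (l ord0 i) (l' ord0 i)).
split=> i; have /andP[? ?] := meet i.
  by rewrite mxE le_max lexx ge_max lr.
by rewrite mxE le_max lexx orbT ge_max lr' andbT.
Qed.

Lemma boxicity_le_isomorphic (G H : sgraph) :
  isomorphic G H -> boxicity_le R b H -> boxicity_le R b G.
Proof.
move=> [f /bij_inj f_inj f_edge] [l [r [lr edge_lr]]].
exists (l \o f), (r \o f); split=> [v i|u v neuv]; first exact: lr.
by rewrite -f_edge edge_lr ?(inj_eq f_inj).
Qed.

Lemma boxicity_leP (G : sgraph) :
  boxicity_le R b G <->
  exists lo hi : 'I_b -> G -> R,
    (forall i v, lo i v <= hi i v) /\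
    (forall u v, u != v ->
       edge u v = [forall i, (lo i u <= hi i v) && (lo i v <= hi i u)]).
Proof.
split=> [[l [r [lr edge_lr]]]|[lo [hi [lohi edge_lohi]]]].
  exists (fun i v => l v ord0 i), (fun i v => r v ord0 i); split=> // u v neuv.
  by apply/idP/forallP => [/(edge_lr _ _ neuv)/box_meet|/box_meet meet];
     [apply|apply/edge_lr/meet].
exists (fun v => \row_i lo i v), (fun v => \row_i hi i v).
have row_lohi v i : (\row_j lo j v) ord0 i <= (\row_j hi j v) ord0 i.
  by rewrite !mxE.
split=> // u v neuv; rewrite edge_lohi // box_meet //.
by split=> [/forallP meet i|meet]; [|apply/forallP => i];
   have := meet i; rewrite !mxE.
Qed.

Lemma word_graph_boxicity_le (A : choiceType) (w : seq A) :
  (0 < b)%N -> boxicity_le R b (word_graph (box_language b) w).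
Proof.
move=> b_gt0; pose coord (u : seq_sub w) := letter_coord w b (val u).
apply/boxicity_leP; exists (fun i u => (coord u (2 * i + 1)%N)%:R).
exists (fun i u => (coord u (2 * i + 2)%N)%:R); split=> [i v|u v neuv].
  by rewrite ler_nat letter_coord_mono ?leq_add2l.
rewrite /edge /= /word_edge neuv /= box_pred_letter_coord ?(valP u) ?(valP v) //.
by apply: eq_forallb => i; rewrite !ler_nat.
Qed.

Lemma boxicity_le_word_graph (G : sgraph) :
  (0 < b)%N -> boxicity_le R b G -> word_graph_class (box_language b) G.
Proof.
move=> b_gt0 /boxicity_leP[lo [hi [lohi edge_lohi]]].
pose w := box_word lo hi.
have count_w v : count_mem v w = (2 * b)%N by apply: count_box_word.
have mem_w v : v \in w by rewrite -has_pred1 has_count count_w muln_gt0.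
exists G, w, (fun v => SeqSub (mem_w v)).
  by exists val => [v|v] //; apply: val_inj.
move=> u v; rewrite [LHS]/edge /= /word_edge -(inj_eq val_inj) /=.
have [->|neuv] := eqVneq u v; first by rewrite edge_irr.
rewrite box_pred_proj // !count_w eqxx edge_lohi //=.
by apply: eq_forallb => i; rewrite sides_meet_box_word.
Qed.

End Boxes.

Theorem theorem4 (R : realType) (b : nat) (hb : (1 <= b)%N) :
  uniform_language (2 * b) (box_language b) /\
  (forall G : sgraph,
     word_graph_class (box_language b) G <-> boxicity_le R b G).
Proof.
split=> [w /and3P[c0 c1 _]|G]; first by rewrite /uniform_word c0 c1.
split=> [[A [w isoG]]|]; last exact: boxicity_le_word_graph.
exact/(boxicity_le_isomorphic isoG)/word_graph_boxicity_le.
Qed.
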